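(* Let $1 \leq p < \infty$ and let $M$ be a pointwise finite dimensional persistence module over $(\mathbb{R},\leq)$ all of whose barcode intervals are finite (bounded). For every $\delta > 0$ there exist $\eta$ with $0 < \eta \leq 1$ and a constant $K_{M,p} > 0$ (depending only on $M$ and $p$) such that every pointwise finite dimensional persistence module $N$ over $(\mathbb{R},\leq)$ satisfying $$d_B(\mathrm{Dgm}(M), \mathrm{Dgm}(N)) < \eta$$ also satisfies $$\left\| \beta_\delta^M - \beta_\delta^N \right\|_p \leq K_{M,p} \cdot d_B(\mathrm{Dgm}(M), \mathrm{Dgm}(N))^{1/p}.$$
   Context: Persistence modules. Fix a field $\mathbb{F}$. A pointwise finite dimensional (p.f.d.) persistence module is a functor $M$ from the poset category $(\mathbb{R},\leq)$ to finite dimensional $\mathbb{F}$-vector spaces. For $b<d$ (with $d$ possibly $+\infty$), the interval module $\mathbb{I}[b,d)$ equals $\mathbb{F}$ at every $x$ with $b \leq x < d$ and $0$ elsewhere, with identity maps between the nonzero copies of $\mathbb{F}$. Standing convention: every persistence module considered is isomorphic to a finite direct sum of interval modules $\mathbb{I}[b_1,d_1) \oplus \cdots \oplus \mathbb{I}[b_m,d_m)$, unique up to reordering; the multiset of intervals $[b_i,d_i)$ is its barcode. Rank functions. Let $\mathbb{R}^{2+} = \{(x,y) \in (\{-\infty\}\cup\mathbb{R}) \times (\mathbb{R}\cup\{\infty\}) : x \leq y\}$. The rank function of $M$ is $\beta^M : \mathbb{R}^{2+} \to \mathbb{Z}$, $\beta^M(x,y) = \operatorname{rank} M(x \leq y)$.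 (Points with an infinite coordinate play no role for the integrals below.) For $\delta>0$, the $\delta$-truncated rank function is $\beta^M_\delta = \beta^M \cdot \mathbf{1}_{\mathbb{R}^{2+}_\delta}$, where $\mathbf{1}$ denotes the indicator function and $\mathbb{R}^{2+}_\delta = \{(x,y)\in\mathbb{R}^{2+} : y > x+\delta\}$. Norm. $\|f\|_p = \left(\int_{\mathbb{R}^{2+}} |f|^p \, d\omega\right)^{1/p}$, where $\omega$ is two-dimensional Lebesgue measure. Persistence diagrams and bottleneck distance. $\mathrm{Dgm}(M)$ is the multiset consisting of the points $(b_i,d_i)$ for the intervals $[b_i,d_i)$ in the barcode of $M$ (with multiplicity), together with every point of the diagonal $\{(x,x)\}$ counted with infinite multiplicity. The bottleneck distance is $$d_B(D_1,D_2) = \inf_{\phi}\ \sup_{x\in D_1} \|x-\phi(x)\|_\infty,$$ where $\phi$ ranges over all bijections of multisets $D_1\to D_2$ and $\|\cdot\|_\infty$ is the $\ell^\infty$ norm on $\mathbb{R}^2$. *)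

(* Defs.v *)
From HB Require Import structures.
From mathcomp Require Import all_boot all_order all_algebra.
From mathcomp Require Import all_classical all_reals all_analysis.

Set Implicit Arguments.
Unset Strict Implicit.
Unset Printing Implicit Defensive.

Import Order.TTheory GRing.Theory Num.Theory.
Import numFieldNormedType.Exports.

Local Open Scope classical_set_scope.
Local Open Scope ring_scope.

Section PersistenceModules.
Variables (F : fieldType) (R : realType).

(* A functor from the poset (R, <=) to finite dimensional F-vector spaces. *)
Record pfunctor := PFunctor {
  pspace : R -> vectType F;
  pmap : forall x y : R, x <= y -> 'Hom(pspace x, pspace y);
  pmap_id : forall (x : R) (xx : x <= x), pmap xx = \1%VF;
  pmap_comp : forall (x y z : R) (xy : x <= y) (yz : y <= z) (xz : x <= z),
    pmap xz = (pmap yz \o pmap xy)%VF }.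

Definition pisomorphic (M N : pfunctor) : Prop :=
  exists f : forall x : R, 'Hom(pspace M x, pspace N x),
    (forall x, bijective (f x)) /\
    (forall (x y : R) (xy : x <= y),
       (f y \o pmap M xy = pmap N xy \o f x)%VF).

(* An interval [birth, death); death may be +oo, and is never -oo. *)
Record bar := Bar {
  birth : R;
  death : \bar R;
  birth_lt_death : (birth%:E < death)%E }.

Definition in_bar (I : bar) (x : R) : bool :=
  (birth I <= x) && (x%:E < death I)%E.

Lemma in_bar_convex (I : bar) (x y z : R) :
  x <= y -> y <= z -> in_bar I x -> in_bar I z -> in_bar I y.
Proof.
move=> xy yz /andP[bx _] /andP[_ zd]; rewrite /in_bar (le_trans bx xy) /=.
by apply: le_lt_trans zd; rewrite lee_fin.
Qed.

(* The booleans [in_bar I x] are read as dimensions 0 or 1; [pid_mx 1] is then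
   the identity of F if both x and y lie in I, and 0 otherwise. *)
Definition interval_space (I : bar) (x : R) : vectType F := 'rV[F]_(in_bar I x).

Definition interval_map (I : bar) (x y : R) (_ : x <= y) :
    'Hom(interval_space I x, interval_space I y) :=
  linfun (mulmxr (pid_mx 1 : 'M[F]_(in_bar I x, in_bar I y))).

Lemma interval_map_id (I : bar) (x : R) (xx : x <= x) :
  interval_map I xx = \1%VF.
Proof.
apply/lfunP => u; rewrite lfunE id_lfunE /=.
by move: u; rewrite /interval_space; case: in_bar => u;
  rewrite ?[u]thinmx0 ?mul0mx ?pid_mx_1 ?mulmx1.
Qed.

Lemma interval_map_comp (I : bar) (x y z : R)
    (xy : x <= y) (yz : y <= z) (xz : x <= z) :
  interval_map I xz = (interval_map I yz \o interval_map I xy)%VF.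
Proof.
apply/lfunP => u; rewrite comp_lfunE !lfunE /= -mulmxA mul_pid_mx.
congr (_ *m _); have := @in_bar_convex I x y z xy yz.
case: (in_bar I x) => [|_]; last by rewrite [LHS]flatmx0 [RHS]flatmx0.
case: (in_bar I z) => [|_]; last by rewrite [LHS]thinmx0 [RHS]thinmx0.
by move=> /(_ isT isT) ->.
Qed.

Definition interval_module (I : bar) : pfunctor :=
  PFunctor (@interval_map_id I) (@interval_map_comp I).

Definition zero_module : pfunctor.
Proof.
by refine (@PFunctor (fun=> 'rV[F]_0) (fun _ _ _ => 0) _ _) => *;
  apply/lfunP => u; rewrite [LHS]thinmx0 [RHS]thinmx0.
Defined.

Section DirectSum.
Variables M N : pfunctor.

Definition dsum_space (x : R) : vectType F := (pspace M x * pspace N x)%type.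

Definition dsum_fun (x y : R) (xy : x <= y) (u : dsum_space x) : dsum_space y :=
  (pmap M xy u.1, pmap N xy u.2).

Lemma dsum_fun_is_linear (x y : R) (xy : x <= y) : linear (dsum_fun xy).
Proof. by move=> a u v; rewrite /dsum_fun /= !linearP. Qed.

HB.instance Definition _ (x y : R) (xy : x <= y) :=
  GRing.isLinear.Build F (dsum_space x) (dsum_space y) _ (dsum_fun xy)
    (dsum_fun_is_linear xy).

Definition dsum_map (x y : R) (xy : x <= y) :
    'Hom(dsum_space x, dsum_space y) := linfun (dsum_fun xy).

Lemma dsum_map_id (x : R) (xx : x <= x) : dsum_map xx = \1%VF.
Proof.
apply/lfunP => u; rewrite lfunE id_lfunE /= /dsum_fun !pmap_id !id_lfunE.
by case: u.
Qed.

Lemma dsum_map_comp (x y z : R) (xy : x <= y) (yz : y <= z) (xz : x <= z) :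
  dsum_map xz = (dsum_map yz \o dsum_map xy)%VF.
Proof.
apply/lfunP => u; rewrite comp_lfunE !lfunE /= /dsum_fun.
by rewrite (pmap_comp M xy yz) (pmap_comp N xy yz) !comp_lfunE.
Qed.

Definition dsum : pfunctor := PFunctor dsum_map_id dsum_map_comp.

End DirectSum.

Definition bar_module (s : seq bar) : pfunctor :=
  foldr (fun I M => dsum (interval_module I) M) zero_module s.

(* Persistence modules are, by convention, functors isomorphic to a finite
   direct sum of interval modules. *)
Record pmodule := PModule {
  pmodule_functor :> pfunctor;
  decomposable : exists s : seq bar, pisomorphic pmodule_functor (bar_module s) }.

(* The list of intervals is unique up to reordering; one ordering is chosen. *)
Definition barcode (M : pmodule) : seq bar := sval (cid (decomposable M)).

(* Only points with finite coordinates are considered: those with an infinite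
   coordinate do not contribute to the integrals. *)
Definition R2plus : set (R * R) := [set z | z.1 <= z.2].

Definition R2plus_delta (delta : R) : set (R * R) :=
  [set z | z.1 + delta < z.2].

(* Extended by 0 outside [R2plus]. *)
Definition rank_function (M : pmodule) (z : R * R) : int :=
  match @idP (z.1 <= z.2) with
  | ReflectT xy => (\dim (limg (pmap M xy)))%:Z
  | ReflectF _ => 0
  end.

Definition truncated_rank_function (M : pmodule) (delta : R) (z : R * R) : int :=
  rank_function M z * \1_(R2plus_delta delta) z.

(* [\_ R2plus] restricts to R2plus, with value [point] = 0 elsewhere. *)
Definition R2plus_norm (p : R) (f : R * R -> int) : \bar R :=
  'N[(lebesgue_measure \x lebesgue_measure)%E]_(p%:E)
    [EFin \o ((fun z => (f z)%:~R : R) \_ R2plus)]%E.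

(* The multiset {dpoint i | i : dindex}: elements are indices, so that repeated
   points are distinct elements and bijections of multisets are bijections of
   index types. *)
Record diagram := Diagram {
  dindex : Type;
  dpoint : dindex -> R * \bar R }.

(* [inl i] is the i-th interval; [inr (x, k)] is the k-th copy of (x, x). *)
Definition Dgm (M : pmodule) : diagram :=
  @Diagram ('I_(size (barcode M)) + R * nat)%type (fun i =>
    match i with
    | inl j => let I := tnth (in_tuple (barcode M)) j in (birth I, death I)
    | inr xk => (xk.1, xk.1%:E)
    end).

(* The distance |a - b| with the convention |oo - oo| = 0 for equal
   infinities, unlike [`|a - b|] in \bar R. *)
Definition edistance (a b : \bar R) : \bar R :=
  match a, b with
  | r%:E, s%:E => `|r - s|%:E
  | +oo, +oo | -oo, -oo => 0
  | _, _ => +oo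
  end%E.

Definition linfty_distance (u v : R * \bar R) : \bar R :=
  maxe `|u.1 - v.1|%:E (edistance u.2 v.2).

Definition bottleneck (D1 D2 : diagram) : \bar R :=
  ereal_inf [set ereal_sup [set linfty_distance (dpoint i) (dpoint (phi i))
                           | i in [set: dindex D1]]
            | phi in [set phi : dindex D1 -> dindex D2 | bijective phi]].

End PersistenceModules.

(* Main.v *)
Require Import Defs.
From HB Require Import structures.
From mathcomp Require Import all_boot all_order all_algebra.
From mathcomp Require Import all_classical all_reals all_analysis.
From mathcomp Require Import measurable_realfun zify lra.

Set Implicit Arguments.
Unset Strict Implicit.
Unset Printing Implicit Defensive.

Import Order.TTheory GRing.Theory Num.Theory.
Import numFieldNormedType.Exports.

Local Open Scope classical_set_scope.
Local Open Scope ring_scope.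

(** The rank function of a barcode counts, at (x, y), the bars with b <= x and
    y < d.  Take a matching of cost eps with 2 eps <= delta.  A bar matched with
    the diagonal has length at most 2 eps, so it is invisible in the
    delta-truncated rank function; hence the discrepancy between M and N at z is
    at most the number of bars I of M such that exactly one of I and its partner
    counts at z.  Such a z lies in one of two rectangles attached to I, of
    thickness 2 eps around x = b and around y = d respectively.  Bounding the
    p-th power of the discrepancy by m^p times the number of these rectangles
    containing z and integrating gives an upper bound linear in eps with a
    constant depending on M and p only; then let eps decrease to the bottleneck
    distance. *)

(** * Ranks under isomorphisms and direct sums *)

Lemma dim_limg_isomorphic (F : fieldType) (U U' V V' : vectType F)
    (f : 'Hom(U, V)) (g : 'Hom(U', V')) (h : 'Hom(U, U')) (k : 'Hom(V, V')) :
  bijective h -> bijective k -> (k \o f = g \o h)%VF ->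
  \dim (limg f) = \dim (limg g).
Proof.
move=> hb kb kfgh.
have k0 : lker k == 0%VS by apply/lker0P; exact: bij_inj.
have hT : limg h = fullv.
  case: hb => h' _ h'K; apply/vspaceP => v; rewrite memvf -[v]h'K.
  by rewrite memv_img ?memvf.
rewrite -[in RHS]hT -limg_comp -kfgh limg_comp [in RHS]limg_dim_eq//.
by rewrite (eqP k0) capv0.
Qed.

Section PairDim.
Variables (F : fieldType) (V W : vectType F).

Definition inject_left (v : V) : (V * W)%type := (v, 0).
Definition inject_right (w : W) : (V * W)%type := (0, w).

Lemma inject_left_is_linear : linear inject_left.
Proof. by move=> a u v; congr pair; rewrite /= scaler0 addr0. Qed.

Lemma inject_right_is_linear : linear inject_right.
Proof. by move=> a u v; congr pair; rewrite /= scaler0 addr0. Qed.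

HB.instance Definition _ :=
  GRing.isLinear.Build F V (V * W)%type _ inject_left inject_left_is_linear.
HB.instance Definition _ :=
  GRing.isLinear.Build F W (V * W)%type _ inject_right inject_right_is_linear.

(** The image of [h] is the direct sum of the injected images of [f] and [g]. The hypothesis on [h]
    is pointwise so that it applies to the [linfun] defining a direct sum of modules. *)
Lemma dim_limg_pair (U U' : vectType F) (f : 'Hom(U, V)) (g : 'Hom(U', W))
    (h : 'Hom((U * U')%type, (V * W)%type)) :
  (forall u, h u = (f u.1, g u.2)) ->
  \dim (limg h) = (\dim (limg f) + \dim (limg g))%N.
Proof.
move=> hE.
pose jl : 'Hom(V, (V * W)%type) := linfun inject_left.
pose jr : 'Hom(W, (V * W)%type) := linfun inject_right.
have jl0 : lker jl == 0%VS by apply/lker0P => u v; rewrite !lfunE => -[].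
have jr0 : lker jr == 0%VS by apply/lker0P => u v; rewrite !lfunE => -[].
have -> : limg h = (jl @: limg f + jr @: limg g)%VS.
  apply/eqP; rewrite eqEsubv; apply/andP; split.
    apply/subvP => _ /memv_imgP[u _ ->].
    have -> : h u = jl (f u.1) + jr (g u.2).
      by rewrite hE !lfunE /=; congr pair; rewrite ?addr0 ?add0r.
    by apply: memv_add; do 2!apply: memv_img; exact: memvf.
  rewrite subv_add; apply/andP; split;
    apply/subvP => _ /memv_imgP[_ /memv_imgP[u _ ->] ->].
    have -> : jl (f u) = h (u, 0) by rewrite hE !lfunE /= /inject_left linear0.
    exact/memv_img/memvf.
  have -> : jr (g u) = h (0, u) by rewrite hE !lfunE /= /inject_right linear0.
  exact/memv_img/memvf.
rewrite dimv_disjoint_sum.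
  by congr addn; apply: limg_dim_eq; rewrite (eqP jl0, eqP jr0) capv0.
apply/eqP; rewrite -subv0; apply/subvP => v /memv_capP[].
move=> /memv_imgP[a _ ->] /memv_imgP[b _]; rewrite !lfunE => -[-> _].
by rewrite memv0.
Qed.

End PairDim.

(** * The rank function as a count of bars *)

Section Rank.
Variables (F : fieldType) (R : realType).

Definition covers (I : bar R) (z : R * R) : bool :=
  (birth I <= z.1) && (z.2%:E < death I)%E.

Lemma in_bar_covers (I : bar R) (x y : R) :
  x <= y -> in_bar I x && in_bar I y = covers I (x, y).
Proof.
rewrite /in_bar /covers /= => xy; apply/idP/idP.
  by move=> /andP[/andP[-> _] /andP[_ ->]].
move=> /andP[bx yd]; rewrite bx yd (le_trans bx xy) /= andbT.
by apply: le_lt_trans yd; rewrite lee_fin.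
Qed.

Lemma dim_limg_interval_map (I : bar R) (x y : R) (xy : x <= y) :
  \dim (limg (interval_map F I xy)) = (in_bar I x && in_bar I y : nat).
Proof.
rewrite /interval_map /interval_space.
case: (in_bar I x); case: (in_bar I y) => /=.
- rewrite pid_mx_1 (_ : linfun _ = \1%VF) ?lim1g ?dimvf ?dim_matrix//.
  by apply/lfunP => u; rewrite lfunE id_lfunE /= mulmx1.
- by apply/eqP; rewrite -leqn0 (leq_trans (dimvS (subvf _)))// dimvf dim_matrix.
(* Here the domain has dimension 0, so rank-nullity kills the image; in the other two zero cases the
   codomain has dimension 0. *)
- set f := linfun _.
  have /eqP : (\dim (fullv :&: lker f) + \dim (limg f) = 0)%N.
    by rewrite limg_ker_dim dimvf dim_matrix.
  by rewrite addn_eq0 => /andP[_ /eqP].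
- by apply/eqP; rewrite -leqn0 (leq_trans (dimvS (subvf _)))// dimvf dim_matrix.
Qed.

Lemma dim_limg_bar_module (s : seq (bar R)) (x y : R) (xy : x <= y) :
  \dim (limg (Defs.pmap (bar_module F s) xy)) = count (covers^~ (x, y)) s.
Proof.
elim: s => [|I s IHs] /=.
  by apply/eqP; rewrite -leqn0 (leq_trans (dimvS (subvf _)))// dimvf dim_matrix.
rewrite -IHs -(in_bar_covers _ xy) -(dim_limg_interval_map I xy).
by apply: dim_limg_pair => u; rewrite lfunE.
Qed.

Lemma rank_functionE (M : pmodule F R) (z : R * R) : z.1 <= z.2 ->
  rank_function M z = (count (covers^~ z) (barcode M))%:Z.
Proof.
move=> z12; rewrite /rank_function; case: {-}_ / idP => // xy.
rewrite /barcode; case: cid => s /= [h [hb hM]]; congr Posz.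
rewrite (dim_limg_isomorphic (hb _) (hb _) (hM _ _ xy)).
by rewrite dim_limg_bar_module -surjective_pairing.
Qed.

End Rank.

(** * Comparing cardinalities along a partial matching *)

Lemma leq_card_correspondence (T U : finType) (A : {set T}) (B : {set U})
    (r : T -> U -> Prop) :
  (forall a, a \in A -> exists2 b, b \in B & r a b) ->
  (forall a a' b, r a b -> r a' b -> a = a') ->
  (#|A| <= #|B|)%N.
Proof.
move=> AB r_inj.
(* [option U] supplies a value off [A], since [U] may be empty. *)
have /choice[f fP] : forall a, exists o : option U,
    a \in A -> exists2 b, b \in B & o = Some b /\ r a b.
  move=> a; have [/AB[b bB rab]|_] := boolP (a \in A); last by exists None.
  by exists (Some b) => _; exists b.
have f_inj : {in A &, injective f}.
  move=> a a' /fP[b _ [-> rab]] /fP[b' _ [-> ra'b']] [bb'].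
  by apply: r_inj rab _; rewrite bb'.
rewrite -(card_in_imset f_inj) -(card_imset (mem B) Some_inj).
apply/subset_leq_card/fintype.subsetP => _ /imsetP[a /fP[b bB [-> _]] ->].
exact: imset_f.
Qed.

Lemma count_tnth (T : Type) (a : pred T) (s : seq T) :
  count a s = #|[set i : 'I_(size s) | a (tnth (in_tuple s) i)]%SET|.
Proof. by rewrite -sum1_count big_tnth -sum1dep_card. Qed.

(** * Points where two close bars disagree *)

Section Strips.
Variable R : realType.
Implicit Types (I J : bar R) (z : R * R).

(** The points above the diagonal covered by a bar form a triangle; this strip and the next surround
    its left edge x = b and its top edge y = d. [fine] is meaningful only for a finite death. *)
Definition birth_strip (eps : R) I : set (R * R) :=
  `[birth I - eps, birth I + eps] `*` `[birth I - eps, fine (death I) + eps].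

Definition death_strip (eps : R) I : set (R * R) :=
  `[birth I - eps, fine (death I) + eps] `*`
  `[fine (death I) - eps, fine (death I) + eps].

Definition bar_point I : R * \bar R := (birth I, death I).

Lemma linfty_distanceC (u v : R * \bar R) :
  linfty_distance u v = linfty_distance v u.
Proof.
rewrite /linfty_distance distrC; congr maxe.
by case: u.2 v.2 => [r||] [s||] //=; rewrite distrC.
Qed.

Lemma linfty_distance_ge0 (u v : R * \bar R) : (0 <= linfty_distance u v)%E.
Proof. by rewrite le_max lee_fin normr_ge0. Qed.

(** Endpoints move by at most [eps], so the status of z changes only if z.1 is near the birth or z.2
    near the death; the bar that covers z, with [z.1 < z.2], confines the other coordinate. *)
Lemma covers_discrepancy I J (eps : R) z :
  (death I < +oo)%E ->
  (linfty_distance (bar_point I) (bar_point J) <= eps%:E)%E ->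
  z.1 < z.2 -> covers I z != covers J z ->
  (birth_strip eps I `|` death_strip eps I) z.
Proof.
case: I J => [b d bd] [b' d' bd']; rewrite /linfty_distance /covers /=.
rewrite /birth_strip /death_strip /=.
case: d bd => [d||] // bd _; rewrite ge_max.
(* An infinite death would put J at infinite distance from I. *)
case: d' bd' => [d'||]; last 2 first.
- by move=> _ /andP[].
- by [].
move=> _; rewrite /= !lee_fin !ler_norml !lte_fin in bd *.
move=> /andP[/andP[b1 b2] /andP[d1 d2]] z12 ne.
rewrite !in_itv /=.
by case: (lerP b z.1) ne => ?; case: (lerP b' z.1) => ?;
  case: (ltP z.2 d) => ?; case: (ltP z.2 d') => ? //= _;
  first [by left; split; lra | by right; split; lra].
Qed.

(** Birth is at least x - eps and death at most x + eps, so covering z would force z.2 - z.1 < 2 eps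
    <= delta. *)
Lemma near_diagonal_not_covers I (x eps delta : R) z :
  (linfty_distance (bar_point I) (x, x%:E) <= eps%:E)%E ->
  2 * eps <= delta -> z.1 + delta < z.2 -> covers I z = false.
Proof.
case: I => [b [d||] bd] //=; rewrite /linfty_distance /covers /=; last first.
  by rewrite ge_max andbC.
rewrite ge_max !lee_fin !ler_norml lte_fin => {bd} /andP[] ? ? ? ?.
by apply/negbTE/negP => /andP[? ?]; lra.
Qed.

End Strips.

(** * Pointwise rank discrepancy under a matching *)

Section Matching.
Variables (F : fieldType) (R : realType) (M N : pmodule F R).

Local Notation barM i := (tnth (in_tuple (barcode M)) i).
Local Notation barN i := (tnth (in_tuple (barcode N)) i).

(** Bars covering z are never matched with the diagonal, and outside [bad] partners cover z
    together. Hence |SM \ bad| <= |SN| <= |SM ∪ bad|, and both bounds are within |bad| of |SM|. *)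
Lemma rank_function_discrepancy (eps delta : R)
    (phi : dindex (Dgm M) -> dindex (Dgm N)) (z : R * R) :
  (forall i, (death (barM i) < +oo)%E) ->
  bijective phi ->
  (forall i, (linfty_distance (dpoint i) (dpoint (phi i)) <= eps%:E)%E) ->
  0 < delta -> 2 * eps <= delta -> z.1 + delta < z.2 ->
  (absz (rank_function M z - rank_function N z) <=
   #|[set i : 'I_(size (barcode M)) |
       `[< (birth_strip eps (barM i) `|`
             death_strip eps (barM i)) z >]]%SET|)%N.
Proof.
move=> M_bounded [psi phiK psiK] phi_eps delta0 eps_delta zd.
have z12 : z.1 < z.2 by lra.
rewrite !rank_functionE ?ltW// !count_tnth.
set SM := [set i | covers (barM i) z]%SET.
set SN := [set j | covers (barN j) z]%SET.
set bad := [set i | `[< _ >]]%SET.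
have match_bad i j : phi (inl i) = inl j -> i \notin bad ->
    covers (barM i) z = covers (barN j) z.
  move=> ij; apply: contraNeq => ne; rewrite inE; apply/asboolP.
  apply: (covers_discrepancy _ _ z12 ne) => //.
  by have := phi_eps (inl i); rewrite ij.
have matchM i : i \in SM -> exists j, phi (inl i) = inl j.
  rewrite inE => ci; have := phi_eps (inl i).
  case: (phi (inl i)) => [j|[x k]] /= h; first by exists j.
  by rewrite (near_diagonal_not_covers h eps_delta zd) in ci.
have matchN j : j \in SN -> exists i, phi (inl i) = inl j.
  rewrite inE => cj; have := phi_eps (psi (inl j)); rewrite psiK.
  case e : (psi (inl j)) => [i|[x k]] /= h; first by exists i; rewrite -e psiK.
  rewrite linfty_distanceC in h.
  by rewrite (near_diagonal_not_covers h eps_delta zd) in cj.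
have le_MN : (#|SM :\: bad| <= #|SN|)%N.
  apply: (@leq_card_correspondence _ _ _ _ (fun i j => phi (inl i) = inl j)).
    move=> i /setDP[iM ibad]; have [j ij] := matchM _ iM; exists j => //.
    by move: iM; rewrite !inE (match_bad _ _ ij).
  by move=> i i' j <- /(can_inj phiK)[].
have le_NM : (#|SN| <= #|SM :|: bad|)%N.
  apply: (@leq_card_correspondence _ _ _ _ (fun j i => phi (inl i) = inl j)).
    move=> j jN; have [i ij] := matchN _ jN; exists i => //.
    have [ibad|ibad] := boolP (i \in bad).
      by rewrite finset.in_setU ibad orbT.
    rewrite finset.in_setU [i \in SM]inE (match_bad _ _ ij ibad).
    by move: jN; rewrite inE => ->.
  by move=> j j' i -> [].
have := cardsID bad SM; have := subset_leq_card (subsetIr SM bad).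
have := (leq_card_setU SM bad).1.
lia.
Qed.

End Matching.

(** * Integrals and areas of strips *)

(** Monotonicity is read off the supremum over simple functions lying below, so it applies directly
    to the rank difference. *)
Lemma ge0_le_integral_setT d (T : measurableType d) (R : realType)
    (mu : {measure set T -> \bar R}) (f g : T -> \bar R) :
  (forall x, 0 <= f x)%E -> (forall x, f x <= g x)%E ->
  (\int[mu]_x f x <= \int[mu]_x g x)%E.
Proof.
move=> f0 fg; have g0 x : (0 <= g x)%E by exact: le_trans (f0 x) (fg x).
rewrite !ge0_integralTE//; apply: ereal_sup_le => _ [h hf <-].
by exists h => // x; exact: le_trans (hf x) (fg x).
Qed.

Lemma integral_sum_indicD d (T : measurableType d) (R : realType)
    (mu : {measure set T -> \bar R}) (n : nat) (A B : 'I_n -> set T) (c : R) :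
  0 <= c -> (forall i, measurable (A i)) -> (forall i, measurable (B i)) ->
  (\int[mu]_x (c * \sum_(i < n) (\1_(A i) x + \1_(B i) x))%:E =
   c%:E * \sum_(i < n) (mu (A i) + mu (B i)))%E.
Proof.
move=> c0 mA mB.
have m1 (S : set T) : measurable S ->
    measurable_fun setT (EFin \o (\1_S : T -> R)).
  by move=> mS; apply/measurable_EFinP/measurable_indic.
under eq_integral do rewrite EFinM -sumEFin.
under eq_integral do under eq_bigr do rewrite EFinD.
have mAB i : measurable_fun setT
    (fun x => ((\1_(A i) x)%:E + (\1_(B i) x)%:E)%E : \bar R).
  by apply: emeasurable_funD; exact: m1.
rewrite ge0_integralZl_EFin//; last 2 first.
- move=> z _; apply: sume_ge0 => i _.
  by rewrite -EFinD lee_fin addr_ge0 ?indic_ge0.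
- exact: emeasurable_sum.
rewrite ge0_integral_sum//; last first.
  by move=> i z _; rewrite -EFinD lee_fin addr_ge0 ?indic_ge0.
congr mule; apply: eq_bigr => i _; rewrite ge0_integralD//;
  do ?[by move=> z _; rewrite lee_fin indic_ge0 | exact: m1].
by rewrite !integral_indic ?setIT.
Qed.

Section Integral.
Variable R : realType.

Local Notation mu2 := (@lebesgue_measure R \x @lebesgue_measure R)%E.

Lemma measurable_rectangle (a b c d : R) :
  measurable (`[a, b] `*` `[c, d] : set (R * R)).
Proof. by apply: measurableX; exact: measurable_itv. Qed.

Lemma lebesgue_measure_rectangle (a b c d : R) : a <= b -> c <= d ->
  mu2 (`[a, b] `*` `[c, d]) = ((b - a) * (d - c))%:E.
Proof.
move=> ab cd; rewrite product_measure1E//.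
(* The general length formula branches on x < y; the degenerate case x = y arises when [eps] is
   0. *)
have E (x y : R) : x <= y ->
    lebesgue_measure (`[x, y]%classic : set R) = (y - x)%:E.
  rewrite lebesgue_measure_itv/= lte_fin EFinB le_eqVlt => /orP[/eqP->|->//].
  by rewrite ltxx subee.
by rewrite EFinM; congr mule; exact: E.
Qed.

Definition strips_indicator (eps : R) (I : bar R) (z : R * R) : R :=
  \1_(birth_strip eps I) z + \1_(death_strip eps I) z.

Lemma strips_indicator_ge0 eps I z : 0 <= strips_indicator eps I z.
Proof. by rewrite addr_ge0 ?indic_ge0. Qed.

(** Each strip has sides 2 eps and d - b + 2 eps; [eps <= 1] makes the total area linear in
    [eps]. *)
Lemma strips_area_le eps I : 0 <= eps <= 1 -> (death I < +oo)%E ->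
  (mu2 (birth_strip eps I) + mu2 (death_strip eps I) <=
   (4 * (fine (death I) - birth I + 2) * eps)%:E)%E.
Proof.
case: I => [b [d||] bd] // /andP[eps0 eps1] _.
have b_lt_d : b < d by rewrite -lte_fin.
rewrite /birth_strip /death_strip /=. rewrite {bd}.
have side x y : x <= y -> x - eps <= y + eps by lra.
rewrite !lebesgue_measure_rectangle ?(side b d (ltW b_lt_d)) ?side//.
by rewrite -EFinD lee_fin; nra.
Qed.

Lemma integral_sum_strips_le (n : nat) (I : 'I_n -> bar R) (c eps : R) :
  0 <= c -> 0 <= eps <= 1 -> (forall i, death (I i) < +oo)%E ->
  (\int[mu2]_z (c * \sum_(i < n) strips_indicator eps (I i) z)%:E <=
   (c * (\sum_(i < n) 4 * (fine (death (I i)) - birth (I i) + 2)) * eps)%:E)%E.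
Proof.
move=> c0 eps01 I_bounded; rewrite /strips_indicator.
rewrite integral_sum_indicD//; try by move=> i; exact: measurable_rectangle.
rewrite -mulrA EFinM; apply: lee_wpmul2l; first by rewrite lee_fin.
rewrite mulr_suml -sumEFin; apply: lee_sum => i _.
exact: strips_area_le.
Qed.

Lemma strips_indicator_ge1 eps I z :
  (birth_strip eps I `|` death_strip eps I) z -> 1 <= strips_indicator eps I z.
Proof.
rewrite /strips_indicator !indicE => -[] zI.
  by rewrite mem_set// lerDl.
by rewrite [z \in death_strip _ _]mem_set// lerDr.
Qed.

End Integral.

(** * Pointwise bound on the integrand *)

Section TruncatedRank.
Variables (F : fieldType) (R : realType) (M N : pmodule F R).

Local Notation barM i := (tnth (in_tuple (barcode M)) i).
Local Notation mu2 := (@lebesgue_measure R \x @lebesgue_measure R)%E.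
Local Notation m := (size (barcode M)).

Definition truncated_difference (delta : R) (z : R * R) : int :=
  truncated_rank_function M delta z - truncated_rank_function N delta z.

(** If z is in no strip, the difference vanishes. Otherwise it is at most [m] in absolute value and
    the sum is at least 1, so no p-th power of a sum has to be expanded. *)
Lemma truncated_difference_powR_le (p eps delta : R)
    (phi : dindex (Dgm M) -> dindex (Dgm N)) (z : R * R) :
  1 <= p ->
  (forall i, (death (barM i) < +oo)%E) ->
  bijective phi ->
  (forall i, (linfty_distance (dpoint i) (dpoint (phi i)) <= eps%:E)%E) ->
  0 < delta -> 2 * eps <= delta ->
  `| ((fun z => (truncated_difference delta z)%:~R : R)
        \_ (@R2plus R)) z | `^ p <=
  m%:R `^ p * \sum_(i < m) strips_indicator eps (barM i) z.
Proof.
move=> p1 M_bounded phi_bij phi_eps delta0 eps_delta.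
have p0 : 0 < p by lra.
have sum0 : 0 <= \sum_(i < m) strips_indicator eps (barM i) z.
  by apply: sumr_ge0 => i _; exact: strips_indicator_ge0.
have rhs0 : 0 <= m%:R `^ p * \sum_(i < m) strips_indicator eps (barM i) z.
  by rewrite mulr_ge0 ?powR_ge0.
rewrite patchE; case: ifPn => _; last by rewrite normr0 powR0 ?gt_eqF.
rewrite /truncated_difference /truncated_rank_function indicE.
have [|_] := boolP (z \in R2plus_delta delta); last first.
  by rewrite !mulr0 subrr normr0 powR0 ?gt_eqF.
rewrite inE /= !mulr1 => zd.
have := rank_function_discrepancy M_bounded phi_bij phi_eps delta0 eps_delta zd.
set bad := [set i | _]%SET; set r := (_ - _ : int) => r_bad.
have -> : `|r%:~R : R| = (absz r)%:R by rewrite -intr_norm -abszE.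
have [bad0|[i]] := set_0Vmem bad.
  by move: r_bad; rewrite bad0 cards0 leqn0 => /eqP ->; rewrite powR0 ?gt_eqF.
rewrite inE => /asboolP /strips_indicator_ge1 i1.
rewrite -[leLHS]mulr1 ler_pM ?powR_ge0//.
  rewrite ge0_ler_powR ?(ltW p0) ?nnegrE ?ler0n// ler_nat.
  by rewrite (leq_trans r_bad)// -[leqRHS]card_ord max_card.
rewrite (bigD1 i)//= (le_trans i1)// lerDl.
by apply: sumr_ge0 => j _; exact: strips_indicator_ge0.
Qed.

End TruncatedRank.

(** * Extracting matchings from the bottleneck distance *)

Section Bottleneck.
Variables (F : fieldType) (R : realType) (M N : pmodule F R).

Lemma bottleneck_ge0 : (0 <= bottleneck (Dgm M) (Dgm N))%E.
Proof.
apply: le_ereal_inf_tmp => _ [phi _ <-]; apply: le_ereal_sup_tmp.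
(* A diagonal point keeps the supremum from being over an empty set, where it would be -oo, even if
   M has no bars. *)
pose i : dindex (Dgm M) := inr (0, 0%N).
exists (linfty_distance (dpoint i) (dpoint (phi i))); first by exists i.
exact: linfty_distance_ge0.
Qed.

Lemma bottleneck_lt (eps : R) :
  (bottleneck (Dgm M) (Dgm N) < eps%:E)%E ->
  exists2 phi : dindex (Dgm M) -> dindex (Dgm N), bijective phi &
    forall i, (linfty_distance (dpoint i) (dpoint (phi i)) <= eps%:E)%E.
Proof.
move=> /ereal_inf_lt[_ [phi phi_bij <-] /ltW sup_le]; exists phi => // i.
by apply: le_trans sup_le; apply: ereal_sup_ubound; exists i.
Qed.

End Bottleneck.

(** * Choice of constants and passage to the infimum *)

Theorem proposition10 (F : fieldType) (R : realType) (p : R) (p_ge1 : 1 <= p)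
    (M : pmodule F R)
    (M_bounded : forall i : 'I_(size (barcode M)),
       (death (tnth (in_tuple (barcode M)) i) < +oo)%E) :
  exists K : R, 0 < K /\
    forall delta : R, 0 < delta ->
      exists eta : R, 0 < eta /\ eta <= 1 /\
        forall N : pmodule F R,
          (bottleneck (Dgm M) (Dgm N) < eta%:E)%E ->
          (R2plus_norm p (fun z : R * R => truncated_rank_function M delta z -
                                           truncated_rank_function N delta z)%R
           <= K%:E * bottleneck (Dgm M) (Dgm N) `^ p^-1)%E.

Proof.
set m := size (barcode M).
set bar_M := tnth (in_tuple (barcode M)) in M_bounded *.
have p0 : 0 < p by lra.
(* The product is the coefficient of [eps] in [integral_sum_strips_le]; adding 1 keeps [C] positive
   when the barcode is empty. *)
pose C : R := m%:R `^ p *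
  (\sum_(i < m) 4 * (fine (death (bar_M i)) - birth (bar_M i) + 2)) + 1.
have C0 : 0 < C.
  rewrite ltr_wpDl// mulr_ge0 ?powR_ge0// sumr_ge0// => i _.
  case: (bar_M i) (M_bounded i) => [b [d||] bd] // _ /=.
  have : b < d by rewrite -lte_fin.
  lra.
exists (C `^ p^-1); split; first exact: powR_gt0.
(* The bound 1 serves the area estimate; delta / 2 makes bars matched with the diagonal
   invisible. *)
move=> delta delta0; exists (Num.min 1 (delta / 2)).
split; first by rewrite lt_min; lra.
split; first by rewrite ge_min lexx.
move=> N; have B0 := bottleneck_ge0 M N; set B := bottleneck _ _ in B0 *.
case B_eq : B B0 => [d||]// d0 d_eta; rewrite lee_fin in d0.
rewrite lte_fin lt_min in d_eta; have /andP[d_lt1 d_lt_delta] := d_eta.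
have int_le : (\int[@lebesgue_measure R \x @lebesgue_measure R]_z
    (`| ((fun z => (truncated_difference M N delta z)%:~R : R)
           \_ (@R2plus R)) z | `^ p)%:E
    <= (C * d)%:E)%E.
  (* The infimum d may not be attained, so a matching of cost [eps] slightly above d is used, at the
     price of an arbitrary slack [e]. *)
  apply/lee_addgt0Pr => e e0.
  (* The three terms secure, in order, [eps <= 1], [2 * eps <= delta] and [C * eps <= C * d + e]. *)
  pose step := Num.min (Num.min ((1 - d) / 2) ((delta / 2 - d) / 2)) (e / C).
  pose eps := d + step.
  have eps_d : d < eps.
    by rewrite ltrDl !lt_min [0 < e / C]divr_gt0// andbT; lra.
  have [eps1 eps_delta eps_e] :
      [/\ eps <= 1, 2 * eps <= delta & C * eps <= C * d + e].
    have le_eps x : step <= x -> eps <= d + x by rewrite lerD2l.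
    have h1 : eps <= d + (1 - d) / 2 by apply: le_eps; rewrite !ge_min lexx.
    have h2 : eps <= d + (delta / 2 - d) / 2.
      by apply: le_eps; rewrite !ge_min lexx orbT.
    have h3 : eps <= d + e / C by apply: le_eps; rewrite !ge_min lexx !orbT.
    split; try lra.
    rewrite (le_trans (ler_wpM2l (ltW C0) h3))//.
    by rewrite mulrDr mulrCA divff ?gt_eqF// mulr1.
  have [phi phi_bij phi_eps] : exists2 phi : dindex (Dgm M) -> dindex (Dgm N),
      bijective phi &
      forall i, (linfty_distance (dpoint i) (dpoint (phi i)) <= eps%:E)%E.
    by apply: bottleneck_lt; rewrite -/B B_eq lte_fin.
  have eps0 : 0 <= eps by rewrite (le_trans d0 (ltW eps_d)).
  have eps01 : 0 <= eps <= 1 by rewrite eps0.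
  have strips_le := integral_sum_strips_le (powR_ge0 m%:R p) eps01 M_bounded.
  apply: le_trans (le_trans strips_le _); last first.
    by rewrite -EFinD lee_fin (le_trans _ eps_e)// ler_wpM2r ?lerDl.
  apply: ge0_le_integral_setT => z; first by rewrite lee_fin powR_ge0.
  rewrite lee_fin; exact: (truncated_difference_powR_le _ p_ge1 M_bounded
    phi_bij phi_eps delta0 eps_delta).
(* The right side becomes the 1/p-th power of [C * d], so monotonicity of that power reduces the
   goal to [int_le]. *)
rewrite /R2plus_norm unlock poweR_EFin -EFinM -powRM ?(ltW C0)// -poweR_EFin.
apply: gt0_ler_poweR; rewrite ?invr_ge0 ?(ltW p0) ?in_itv //=.
- by rewrite leey andbT integral_ge0// => z _; exact: poweR_ge0.
- by rewrite leey andbT lee_fin mulr_ge0 ?(ltW C0).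
Qed.
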